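(* Let $L$ be an infinite-dimensional separable complex Hilbert space with a conjugation, and let $\mathcal F$ be the fermionic Fock space over $L$ with number operator $N$. Let $C\in B_2^-(L)$, let $1\le r\le 2$, $s=\frac{2(r-1)}{r}$, and suppose there are real constants $\gamma_r,\delta_r$ such that, on the finite-particle subspace $\mathcal F_0$, $$ \Delta^+(C)^*\Delta^+(C)\le\gamma_r N^s+\delta_r\mathbb 1 . $$ Then $C\in B_{r+\varepsilon}^-(L)$ for all $\varepsilon>0$.
   Context: Inner products are antilinear in the first and linear in the second argument. $L$ is a separable complex Hilbert space with a conjugation $f\mapsto\bar f$ (antilinear isometric involution). Fock representation of the CAR over $L$: $\mathcal F$ is a complex Hilbert space and $f\mapsto a(f)$, $f\mapsto a^\dagger(f)$ are linear maps from $L$ into the bounded operators on $\mathcal F$ with $\{a(f),a(g)\}=0=\{a^\dagger(f),a^\dagger(g)\}$, $\{a(f),a^\dagger(g)\}=(\bar f,g)\mathbb 1$ (anticommutators), $a(f)^*=a^\dagger(\bar f)$, together with a unit vector $\Omega\in\mathcal F$ (vacuum) such that $a(f)\Omega=0$ for all $f\in L$ and the vectors $a^\dagger(f_n)\cdots a^\dagger(f_1)\Omega$ ($n\ge 0$, $f_i\in L$) span a dense subspace of $\mathcal F$. The $n$-particle space $\mathcal F^{(n)}$ is the closed span of the vectors $a^\dagger(f_n)\cdots a^\dagger(f_1)\Omega$; $\mathcal F$ is the orthogonal sum of the $\mathcal F^{(n)}$, $n\ge0$. $\mathcal F_0$ is the linear span of $\bigcup_n\mathcal F^{(n)}$. The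 transpose of a bounded operator $C$ on $L$ is $C^T:=\bar C^*$, where $\bar C f:=\overline{C\bar f}$. $B_r(L)$, $1\le r<\infty$, is the $r$-th von Neumann-Schatten class on $L$ (compact operators with $\sum_j\mu_j^r<\infty$, $\mu_j$ the singular values), and $B_r^-(L)$ is the set of $C\in B_r(L)$ with $C^T=-C$. For $C\in B_2^-(L)$, $\Delta^+(C):=\sum_j a^\dagger(Ce_j)a^\dagger(\bar e_j)$ on $\mathcal F_0$, where $\{e_j\}$ is a complete orthonormal system in $L$ (well-defined on $\mathcal F_0$; maps $\mathcal F^{(n)}$ into $\mathcal F^{(n+2)}$). The number operator is $N:=\sum_j a^\dagger(e_j)a(\bar e_j)$; $N\Phi=n\Phi$ and $N^s\Phi=n^s\Phi$ for $\Phi\in\mathcal F^{(n)}$, with $N^0=\mathbb 1$. Operator inequalities $X\le Y$ are meant as $(\Phi,X\Phi)\le(\Phi,Y\Phi)$ for all $\Phi\in\mathcal F_0$, with $(\Phi,T^*T\Phi)=\|T\Phi\|^2$. *)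

(* Defs.v *)
From HB Require Import structures.
From mathcomp Require Import all_boot all_order all_algebra.
From mathcomp Require Import complex.
From mathcomp Require Import all_classical all_reals all_analysis.

Set Implicit Arguments.
Unset Strict Implicit.
Unset Printing Implicit Defensive.

Import Order.TTheory GRing.Theory Num.Theory.
Import numFieldNormedType.Exports.

Local Open Scope classical_set_scope.
Local Open Scope ring_scope.
Local Open Scope complex_scope.

(* The norm of a normed module over R[i] takes its values in R[i]; there,
   x <= y means that y - x is a nonnegative real. *)
HB.mixin Record hasInnerProduct (R : realType) H
    of CompleteNormedModule R[i] H := {
  dotp : {dot H for (@Num.conj R[i])};
  dotp_norm : forall f : H, dotp f f = `|f| ^+ 2
}.

#[short(type="hilbertType")]
HB.structure Definition Hilbert (R : realType) :=
  {H of CompleteNormedModule R[i] H & hasInnerProduct R H}.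

(* Library forms are linear in the first argument; [inner] is antilinear in the
   first argument and linear in the second. *)
Definition inner (R : realType) (H : hilbertType R) (f g : H) : R[i] :=
  (dotp : {dot H for _}) g f.

Section LinearSpan.
Variables (K : numFieldType) (V : lmodType K).

Definition lspan (A : set V) : set V :=
  [set v | exists n (c : 'I_n -> K) (x : 'I_n -> V),
     (forall i, A (x i)) /\ v = \sum_(i < n) c i *: x i].

Definition infinite_dimensional : Prop :=
  ~ exists n (x : 'I_n -> V), lspan (range x) = setT.

End LinearSpan.

Definition separable (T : topologicalType) : Prop :=
  exists2 S : set T, countable S & dense S.

Section Operators.
Variables (R : realType) (H : hilbertType R).

Definition is_adjoint (T S : H -> H) : Prop :=
  forall f g, inner f (T g) = inner (S f) g.

Definition complete_orthonormal (e : nat -> H) : Prop :=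
  (forall i j, inner (e i) (e j) = (i == j)%:R) /\
  closure (lspan (range e)) = setT.

Definition compact_operator (T : {linear H -> H}) : Prop :=
  precompact (T @` [set f | `|f| <= 1]).

(* The singular values of T are the eigenvalues of |T| = (T^* T)^(1/2), repeated
   according to multiplicity: the complete orthonormal system u of eigenvectors
   of T^* T lists each eigenvalue mu_j^2 as often as its multiplicity.  As the
   indices range over all of nat, H is understood to be infinite-dimensional;
   the eigenvalue 0 may occur in the list. *)
Definition singular_values (T : {linear H -> H}) (mu : nat -> R) : Prop :=
  (forall j, 0 <= mu j) /\
  exists Ts : H -> H, is_adjoint T Ts /\
  exists2 u : nat -> H, complete_orthonormal u &
    forall j, Ts (T (u j)) = (mu j ^+ 2)%:C *: u j.

Definition schatten (p : R) (T : {linear H -> H}) : Prop :=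
  compact_operator T /\
  exists2 mu : nat -> R, singular_values T mu &
    (\sum_(0 <= j <oo) (mu j `^ p)%:E < +oo)%E.

Record is_conjugation (J : H -> H) : Prop := IsConjugation {
  conjugation_antilinear : forall (c : R[i]) f g,
    J (c *: f + g) = Num.conj c *: J f + J g;
  conjugation_isometry : forall f, `|J f| = `|f|;
  conjugation_involutive : involutive J
}.

Definition conj_op (J : H -> H) (T : H -> H) : H -> H := fun f => J (T (J f)).

Definition is_transpose (J T S : H -> H) : Prop := is_adjoint (conj_op J T) S.

Definition schatten_minus (J : H -> H) (p : R) (T : {linear H -> H}) : Prop :=
  schatten p T /\ is_transpose J T (fun f => - T f).

End Operators.

Section Fock.
Variables (R : realType) (L F : hilbertType R).
Variables (J : L -> L) (a adag : L -> {linear F -> F}) (Omega : F).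

(* a^dagger(f_n) ... a^dagger(f_1) Omega for the list [:: f_n; ...; f_1] *)
Definition creation_vector (fs : seq L) : F :=
  foldr (fun f Phi => adag f Phi) Omega fs.

Record is_fock_representation : Prop := IsFockRepresentation {
  fock_a_bounded : forall f, continuous (a f);
  fock_adag_bounded : forall f, continuous (adag f);
  fock_a_linear : forall (c : R[i]) f g Phi,
    a (c *: f + g) Phi = c *: a f Phi + a g Phi;
  fock_adag_linear : forall (c : R[i]) f g Phi,
    adag (c *: f + g) Phi = c *: adag f Phi + adag g Phi;
  fock_car_aa : forall f g Phi, a f (a g Phi) + a g (a f Phi) = 0;
  fock_car_cc : forall f g Phi,
    adag f (adag g Phi) + adag g (adag f Phi) = 0;
  fock_car_ac : forall f g Phi,
    a f (adag g Phi) + adag g (a f Phi) = inner (J f) g *: Phi;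
  fock_adjoint : forall f, is_adjoint (a f) (adag (J f));
  fock_vacuum_unit : `|Omega| = 1;
  fock_vacuum_annihilated : forall f, a f Omega = 0;
  fock_cyclic : closure (lspan (range creation_vector)) = setT
}.

Definition particle_space (n : nat) : set F :=
  closure (lspan [set creation_vector fs | fs in [set fs | size fs = n]]).

Definition finite_particle : set F := lspan (\bigcup_n particle_space n).

(* N^s on the finite-particle space: n^s on the n-particle space, extended
   linearly; powR satisfies 0 `^ 0 = 1, so that N^0 = 1. *)
Definition number_power (s : R) (Phi : F) : F :=
  get [set Psi | exists m (phi : 'I_m -> F),
    [/\ forall n : 'I_m, particle_space n (phi n),
        Phi = \sum_(n < m) phi n &
        Psi = \sum_(n < m) (n%:R `^ s)%:C *: phi n]].

Definition Delta_plus (e : nat -> L) (C : L -> L) (Phi : F) : F :=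
  limn (series (fun j => adag (C (e j)) (adag (J (e j)) Phi))).

End Fock.

(* Main.v *)
Require Import Defs.
From HB Require Import structures.
From mathcomp Require Import all_boot all_order all_algebra.
From mathcomp Require Import complex.
From mathcomp Require Import all_classical all_reals all_analysis.
From mathcomp Require Import ring zify.

(* The singular vectors of C belonging to singular values at least t span a
   space V on which C is bounded below by t.  Since J C is antilinear and skew,
   one picks greedily from V unit vectors f_k whose partners
   g_k = J C f_k / |C f_k| are orthogonal to f_k and to all earlier f_i, g_i;
   each pair imposes four linear conditions on the next vector, so V of
   dimension n yields M >= n/4 pairs.  In the BCS state
     Phi = prod_k (1 + a^dagger(J f_k) a^dagger(J g_k)) Omega
   one finds |Phi|^2 = 2^M and (Phi, Delta^+(C) Phi) = - 2^M sum_k |C f_k|,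
   so that the assumed bound and Cauchy-Schwarz give
     (M t)^2 <= |gamma| (2 M)^s + |delta|,
   that is, t = O(n^(-1/r)).  Hence the singular values are in weak l^r, and so
   in l^(r + eps). *)

Set Implicit Arguments.
Unset Strict Implicit.
Unset Printing Implicit Defensive.

Import Order.TTheory GRing.Theory Num.Theory.
Import numFieldNormedType.Exports.

Local Open Scope classical_set_scope.
Local Open Scope ring_scope.

(** * Inner products: Cauchy-Schwarz, orthogonality and limits *)

Section InnerTheory.
Variables (R : realType) (H : hilbertType R).
Implicit Types (f g h : H) (c : R[i]).

Lemma innerC f g : inner g f = (inner f g)^*.
Proof.
rewrite /inner [LHS]hermC /=.
by rewrite expr0 mul1r.
Qed.

Fact inner_is_linear f : linear (inner f).
Proof. by move=> c g h; rewrite /inner linearPl. Qed.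

HB.instance Definition _ f :=
  GRing.isLinear.Build R[i] H R[i] *%R (inner f) (inner_is_linear f).

Lemma innerDl f g h : inner (f + g) h = inner f h + inner g h.
Proof. by rewrite innerC linearD rmorphD /= -!innerC. Qed.

Lemma innerZl c f g : inner (c *: f) g = c^* * inner f g.
Proof. by rewrite innerC linearZ rmorphM /= -innerC. Qed.

Lemma innerNl f g : inner (- f) g = - inner f g.
Proof. by rewrite innerC linearN rmorphN /= -innerC. Qed.

Lemma inner0l f : inner 0 f = 0.
Proof. by rewrite innerC linear0 rmorph0. Qed.

Lemma inner_suml I (s : seq I) (P : pred I) (F : I -> H) g :
  inner (\sum_(i <- s | P i) F i) g = \sum_(i <- s | P i) inner (F i) g.
Proof.
rewrite innerC linear_sum rmorph_sum /=; apply: eq_bigr => i _.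
by rewrite -innerC.
Qed.

Lemma inner_normE f : inner f f = `|f| ^+ 2.
Proof. exact: dotp_norm. Qed.

Lemma normD_orthogonal f g :
  inner f g = 0 -> `|f + g| ^+ 2 = `|f| ^+ 2 + `|g| ^+ 2.
Proof.
move=> fg0; rewrite -!inner_normE innerDl !linearD /= fg0 (innerC f g) fg0.
by rewrite rmorph0 addr0 add0r.
Qed.

Lemma inner_CauchySchwarz f g : `|inner f g| <= `|f| * `|g|.
Proof.
have [->|f0] := eqVneq f 0; first by rewrite inner0l !normr0 mul0r.
have nf0 : 0 < `|f| ^+ 2 by rewrite exprn_gt0 ?normr_gt0.
pose c := inner f g / `|f| ^+ 2.
have ort : inner (c *: f) (g - c *: f) = 0.
  rewrite innerZl linearB linearZ /= inner_normE /c divfK ?subrr ?mulr0 //.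
  exact: lt0r_neq0.
have := normD_orthogonal ort; rewrite addrC subrK => ng.
rewrite -ler_sqr ?nnegrE ?mulr_ge0 // exprMn ng normrZ exprMn normf_div.
rewrite (normrX 2 `|f|) normr_id mulrDr.
suff -> : `|f| ^+ 2 * ((`|inner f g| / `|f| ^+ 2) ^+ 2 * `|f| ^+ 2) =
    `|inner f g| ^+ 2 by rewrite lerDl mulr_ge0 ?exprn_ge0.
by field; rewrite normr_eq0.
Qed.

Lemma closure_approx (A : set H) f (eps : R[i]) :
  closure A f -> 0 < eps -> exists2 g, A g & `|f - g| < eps.
Proof.
move=> clA eps0; have [g [Ag /=]] := clA _ (nbhsx_ballx f _ eps0).
by rewrite -ball_normE => ?; exists g.
Qed.

(** Cauchy-Schwarz makes the inner product continuous, so orthogonality passes to the closure in one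
    argument at a time. *)
Lemma inner_closure_eq0 (A B : set H) f g :
  (forall x y, A x -> B y -> inner x y = 0) ->
  closure A f -> closure B g -> inner f g = 0.
Proof.
have lim0 (A' : set H) x y : (forall z, A' z -> inner z y = 0) ->
    closure A' x -> inner x y = 0.
  move=> A'0 clx; apply/eqP; rewrite -normr_le0; apply/ler_addgt0Pr => eps eps0.
  rewrite add0r.
  have d0 : 0 < eps / (1 + `|y|) by rewrite divr_gt0 // ltr_wpDr.
  have [z A'z xz] := closure_approx clx d0.
  have -> : inner x y = inner (x - z) y by rewrite innerDl innerNl (A'0 z) // subr0.
  apply: (le_trans (inner_CauchySchwarz _ _)).
  rewrite (le_trans (ler_wpM2r (normr_ge0 y) (ltW xz))) //.
  rewrite mulrAC ler_pdivrMr ?ltr_wpDr // ler_wpM2l ?(ltW eps0) //.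
  by rewrite lerDr.
move=> AB clA clB; apply: (lim0 A) => // x Ax.
rewrite innerC (lim0 B) ?rmorph0 // => y By.
by rewrite innerC AB ?rmorph0.
Qed.

Lemma inner_cvg (T : Type) (G : set_system T) {FG : Filter G} (u : T -> H) f g :
  u x @[x --> G] --> f ->
  (inner g (u x) : R[i]^o) @[x --> G] --> (inner g f : R[i]^o).
Proof.
move=> /cvgrPdist_lt uf; apply/cvgrPdist_lt => eps eps0.
have d0 : 0 < eps / (1 + `|g|) by rewrite divr_gt0 // ltr_wpDr.
apply: filterS (uf _ d0) => x ux.
rewrite -linearB; apply: (le_lt_trans (inner_CauchySchwarz _ _)).
rewrite (le_lt_trans (ler_wpM2l (normr_ge0 g) (ltW ux))) //.
rewrite mulrCA gtr_pMr // ltr_pdivrMr ?ltr_wpDr // mul1r.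
by rewrite ltrDr.
Qed.

(** * Finite orthonormal families: Bessel and best approximation *)

Section FiniteOrthonormal.
Variables (I : finType) (x : I -> H).
Hypothesis ox : forall i j, inner (x i) (x j) = (i == j)%:R.

Lemma inner_coord (c : I -> R[i]) i : inner (x i) (\sum_j c j *: x j) = c i.
Proof.
rewrite linear_sum (bigD1 i) //= linearZ /= ox eqxx mulr1 big1 ?addr0 // => j.
by move=> /negPf ji; rewrite linearZ /= ox eq_sym ji mulr0.
Qed.

Lemma norm_orthonormal_sum (c : I -> R[i]) :
  `|\sum_i c i *: x i| ^+ 2 = \sum_i `|c i| ^+ 2.
Proof.
rewrite -inner_normE inner_suml; apply: eq_bigr => i _.
by rewrite innerZl inner_coord normCK mulrC.
Qed.

Definition orthonormal_proj f : H := \sum_i inner (x i) f *: x i.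

Lemma orthonormal_proj_ortho f i : inner (x i) (f - orthonormal_proj f) = 0.
Proof. by rewrite linearB /= inner_coord subrr. Qed.

Lemma Bessel f : \sum_i `|inner (x i) f| ^+ 2 <= `|f| ^+ 2.
Proof.
rewrite -norm_orthonormal_sum -/(orthonormal_proj f).
rewrite -[in leRHS](subrKC (orthonormal_proj f) f) normD_orthogonal.
  by rewrite lerDl exprn_ge0.
rewrite inner_suml big1 // => i _.
by rewrite innerZl orthonormal_proj_ortho mulr0.
Qed.

(** The hypothesis puts [g] in the double orthogonal complement of the family, that is, in its span;
    then [f - p] is orthogonal to [p - g] and Pythagoras applies. *)
Lemma orthonormal_proj_best f g :
  (forall h, (forall i, inner (x i) h = 0) -> inner h g = 0) ->
  `|f - orthonormal_proj f| <= `|f - g|.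
Proof.
move=> gx; rewrite -ler_sqr ?nnegrE //.
set p := orthonormal_proj f.
have -> : f - g = (f - p) + (p - g) by rewrite addrA subrK.
suff fpg : inner (f - p) (p - g) = 0.
  by rewrite [leRHS](normD_orthogonal fpg) lerDl exprn_ge0.
rewrite linearB /= gx ?subr0.
  rewrite linear_sum big1 // => i _; rewrite linearZ /= [inner (f - p) _]innerC.
  by rewrite (orthonormal_proj_ortho f i) rmorph0 mulr0.
by move=> i; apply: orthonormal_proj_ortho.
Qed.

End FiniteOrthonormal.

(** * Complete orthonormal sequences: Fourier expansion and Parseval *)

Section CompleteOrthonormal.
Variable (e : nat -> H).
Hypothesis he : complete_orthonormal e.

Lemma orthonormal_prefix n (i j : 'I_n) : inner (e i) (e j) = (i == j)%:R.
Proof. by case: he => ->. Qed.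

(** Completeness gives a finite combination of the [e j] within [eps] of [f]; a partial sum covering
    its indices is an orthogonal projection, hence at least as close. *)
Lemma fourier_cvg f : series (fun j => inner (e j) f *: e j) @ \oo --> f.
Proof.
apply/cvgrPdist_lt => eps eps0.
have fcl : closure (lspan (range e)) f by case: he => _ ->.
have [_ [m [c [y [ye ->]]]] fg] := closure_approx fcl eps0.
have /fin_all_exists[k yk] (i : 'I_m) : exists k, e k = y i.
  by have [k _ <-] := ye i; exists k.
exists (\max_(i < m) (k i).+1)%N => //= n le_n.
rewrite /series /= big_mkord.
apply: le_lt_trans fg; apply: (orthonormal_proj_best (@orthonormal_prefix n)).
move=> h h0; rewrite linear_sum big1 // => i _.
have kn : (k i < n)%N by apply: leq_trans le_n; apply: leq_bigmax.
by rewrite linearZ /= -yk innerC (h0 (Ordinal kn)) rmorph0 mulr0.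
Qed.

Lemma Parseval f g :
  series (fun j => inner g (e j) * inner (e j) f : R[i]^o) @ \oo
    --> (inner g f : R[i]^o).
Proof.
rewrite [X in X @ _ --> _](_ : _ = inner g \o series (fun j => inner (e j) f *: e j)).
  by apply: inner_cvg; apply: fourier_cvg.
apply/funext => n /=.
by rewrite linear_sum; apply: eq_bigr => j _; rewrite linearZ /= mulrC.
Qed.

End CompleteOrthonormal.

End InnerTheory.

(** The order of [R[i]] is partial; realness of the terms and of the limit makes [l - u n]
    comparable with its norm. *)
Lemma cvg_real_ub (R : realType) (u : nat -> R[i]^o) (l M : R[i]) :
  u @ \oo --> (l : R[i]^o) -> l \is Num.real -> (forall n, u n \is Num.real) ->
  (forall n, u n <= M) -> l <= M.
Proof.
move=> /cvgrPdist_lt ul lr ur uM; apply/ler_addgt0Pr => eps eps0.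
have [n _ /(_ n (leqnn n)) /= un] := ul _ eps0.
rewrite -lerBlDl (le_trans _ (ltW un)) // (le_trans _ (real_ler_norm _)) //.
  by rewrite lerB.
by rewrite rpredB.
Qed.

(** * Conjugations and skew operators *)

Section Conjugation.
Variables (R : realType) (L : hilbertType R) (J : L -> L).
Hypothesis hJ : is_conjugation J.

Let J_lin := conjugation_antilinear hJ.
Let JK := conjugation_involutive hJ.

Lemma conjugationD f g : J (f + g) = J f + J g.
Proof. by rewrite -[f]scale1r J_lin rmorph1 !scale1r. Qed.

Lemma conjugation0 : J 0 = 0.
Proof. by apply: (addrI (J 0)); rewrite -conjugationD !addr0. Qed.

Lemma conjugationZ (c : R[i]) f : J (c *: f) = c^* *: J f.
Proof. by rewrite -[c *: f]addr0 J_lin conjugation0 addr0. Qed.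

(** Polarisation: the isometry controls the sum (f, g) + (g, f), and replacing [f] by ['i *: f]
    separates the two terms. *)
Lemma inner_conjugation f g : inner (J f) (J g) = inner g f.
Proof.
have pol h k : inner (J h) (J k) + inner (J k) (J h) = inner h k + inner k h.
  have e (H : hilbertType R) (x y : H) :
      inner x y + inner y x = `|x + y| ^+ 2 - `|x| ^+ 2 - `|y| ^+ 2.
    by rewrite -!inner_normE innerDl !linearD /=; ring.
  by rewrite !e -conjugationD !(conjugation_isometry hJ).
have := pol g f; have := pol g ('i *: f).
rewrite conjugationZ !innerZl !linearZ /= conjCK conjCi => h1 h2.
apply: (mulfI (x := 2%:R * 'i)); first by rewrite mulf_neq0 ?pnatr_eq0 ?neq0Ci.
transitivity ('i * (inner (J g) (J f) + inner (J f) (J g)) +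
  (- 'i * inner (J g) (J f) + 'i * inner (J f) (J g))); first by ring.
by rewrite h1 h2; ring.
Qed.

Variable C : {linear L -> L}.
Hypothesis hCT : is_transpose J C (fun f => - C f).

Lemma skew_inner f g : inner (J f) (C g) = - inner (J g) (C f).
Proof.
have := hCT f (J g); rewrite /conj_op JK innerNl -{1}[f]JK inner_conjugation.
by move=> h; rewrite innerC h rmorphN /= -innerC.
Qed.

Lemma skew_inner_self f : inner (J f) (C f) = 0.
Proof.
have /eqP := skew_inner f f.
by rewrite -addr_eq0 -mulr2n mulrn_eq0 /= => /eqP.
Qed.

(** Transfers a Hilbert-Schmidt bound from the singular basis to the basis used in [Delta_plus]. By
    skewness |(J C e_j, u_l)| = |(J C u_l, e_j)|, so Parseval in [u] and Bessel in [e] compare the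
    two sums. *)
Lemma HilbertSchmidt_le (u e : nat -> L) (S : R[i]) :
  complete_orthonormal u -> complete_orthonormal e ->
  (forall n, \sum_(l < n) `|C (u l)| ^+ 2 <= S) ->
  forall m, \sum_(j < m) `|C (e j)| ^+ 2 <= S.
Proof.
move=> hu he uS m.
have uJC l j : `|inner (J (C (e j))) (u l)| = `|inner (J (C (u l))) (e j)|.
  rewrite -{1}[u l]JK inner_conjugation skew_inner normrN.
  by rewrite -{2}[e j]JK inner_conjugation.
pose w j n : R[i]^o := \sum_(l < n) `|inner (J (C (e j))) (u l)| ^+ 2.
have wr j n : w j n \is Num.real.
  by apply: rpred_sum => l _; apply: rpredX; apply: normr_real.
have wcvg j : w j @ \oo --> (`|C (e j)| ^+ 2 : R[i]^o).
  rewrite -(conjugation_isometry hJ) -inner_normE.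
  have := @Parseval _ _ _ hu (J (C (e j))) (J (C (e j))).
  rewrite [X in X @ _ --> _](_ : _ = w j) //; apply/funext => n.
  rewrite /series /= big_mkord; apply: eq_bigr => l _.
  by rewrite normCK -innerC.
apply: (@cvg_real_ub R (fun n => \sum_(j < m) w j n)).
- apply: (@cvg_big _ _ +%R) => [|j _]; [exact: add_continuous|exact: wcvg].
- by apply: rpred_sum => l _; apply: rpredX; apply: normr_real.
- by move=> n; rewrite rpred_sum.
move=> n; apply: le_trans (uS n); rewrite exchange_big /=.
apply: ler_sum => l _; rewrite -(conjugation_isometry hJ (C (u l))).
under eq_bigr do rewrite uJC innerC norm_conjC.
exact: (Bessel (orthonormal_prefix he (n := m))).
Qed.

End Conjugation.

(** * Greedy choice of orthonormal pairs *)

Section Pairing.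
Variables (R : realType) (L : hilbertType R) (J : L -> L).
Hypothesis hJ : is_conjugation J.
Variable C : {linear L -> L}.
Hypothesis hCT : is_transpose J C (fun f => - C f).

(** The newest pair is at the head. For a real [t] the last inequality also makes (J g, C f)
    real. *)
Fixpoint pairing (t : R[i]) (s : seq (L * L)) : Prop :=
  if s is (f, g) :: s' then
    [/\ pairing t s', [/\ `|f| = 1, `|g| = 1 & inner f g = 0],
      (forall p, p \in s' -> [/\ inner f p.1 = 0, inner f p.2 = 0,
         inner g p.1 = 0 & inner g p.2 = 0])
      & t <= inner (J g) (C f)]
  else True.

(** The conditions form a matrix with more rows than columns, which has a nonzero left kernel
    vector. *)
Lemma exists_orthogonal_combination n (x : 'I_n -> L) (ys : seq L) :
  (size ys < n)%N ->
  exists2 c : 'I_n -> R[i], exists i, c i != 0 &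
    forall y, y \in ys -> inner y (\sum_i c i *: x i) = 0.
Proof.
move=> ltn; pose A := \matrix_(i < n, k < size ys) inner (ys`_k) (x i).
have kA0 : kermx A != 0.
  by rewrite -mxrank_eq0 mxrank_ker subn_eq0 -ltnNge (leq_ltn_trans (rank_leq_col A)).
pose v := nz_row (kermx A).
have vA : v *m A = 0 by apply/sub_kermxP/nz_row_sub.
have : v != 0 by rewrite nz_row_eq0.
have [i vi|v0] := pickP (fun i => v 0 i != 0); last first.
  by case/eqP; apply/rowP => i; rewrite mxE; apply/eqP; have /negbFE := v0 i.
move=> _; exists (v 0); first by exists i.
move=> y /(nthP 0)[k kys <-].
have /matrixP/(_ 0 (Ordinal kys)) := vA; rewrite !mxE => <-.
by rewrite linear_sum; apply: eq_bigr => j _; rewrite linearZ /= mxE.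
Qed.

(** For positive [M], [4 * M < n + 4] says that the 4(M - 1) conditions coming from the earlier
    pairs leave a nonzero vector in the span of the [x i]. *)
Lemma exists_pairing n (x : 'I_n -> L) (t : R[i]) :
  (forall i j, inner (x i) (x j) = (i == j)%:R) -> 0 < t ->
  (forall c, t * `|\sum_i c i *: x i| <= `|C (\sum_i c i *: x i)|) ->
  forall M, (4 * M < n + 4)%N -> exists2 s, size s = M & pairing t s.
Proof.
move=> ox t0 tC; elim=> [|M IH] Mn; first by exists [::].
have [|s sM ps] := IH; first by lia.
(* The first two blocks serve [f] itself; the last two make its partner [g] orthogonal to the
   earlier pairs. *)
pose ys := [seq p.1 | p <- s] ++ [seq p.2 | p <- s] ++
  [seq J (C p.1) | p <- s] ++ [seq J (C p.2) | p <- s].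
have [|c [i ci] cys] := exists_orthogonal_combination x (ys := ys).
  by rewrite !size_cat !size_map sM; lia.
set f0 := \sum_i _ in cys.
have f00 : f0 != 0.
  apply/eqP => f00; have := inner_coord ox c i.
  by rewrite -/f0 f00 linear0 => /esym/eqP; apply/negP.
have nf0 : 0 < `|f0| by rewrite normr_gt0.
pose f := `|f0|^-1 *: f0.
have nf : `|f| = 1 by rewrite normrZ ger0_norm ?invr_ge0 // mulVf ?gt_eqF.
have fys y : y \in ys -> inner f y = 0.
  by move=> ?; rewrite innerC linearZ /= cys // mulr0 rmorph0.
have tf : t <= `|C f|.
  rewrite linearZ /= normrZ ger0_norm ?invr_ge0 // mulrC ler_pdivlMr //.
  exact: tC.
have Cf0 : 0 < `|C f| by apply: lt_le_trans tf.
(* This choice gives (J g, C f) = |C f|, the largest value possible for a unit vector [g]. *)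
pose g := `|C f|^-1 *: J (C f).
have Cfr : (`|C f|^-1)^* = `|C f|^-1 by apply: CrealP; rewrite realV normr_real.
have JCE h p : inner (J (C h)) p = inner (J p) (C h).
  by rewrite -{1}[p](conjugation_involutive hJ) inner_conjugation.
(* By skewness (J C f, p) = - (J C p, f). *)
have gp p : inner f (J (C p)) = 0 -> inner g p = 0.
  move=> fp; rewrite innerZl JCE (skew_inner hJ hCT) -JCE innerC fp.
  by rewrite rmorph0 oppr0 mulr0.
exists ((f, g) :: s); first by rewrite /= sM.
split=> //=.
- split=> //.
    by rewrite normrZ (conjugation_isometry hJ) ger0_norm ?invr_ge0 // mulVf ?gt_eqF.
  by rewrite innerC innerZl JCE (skew_inner_self hJ hCT) mulr0 rmorph0.
- move=> p ps'.
  have [m1 m2] : p.1 \in [seq p.1 | p <- s] /\ p.2 \in [seq p.2 | p <- s].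
    by split; apply: map_f.
  have [m3 m4] : J (C p.1) \in [seq J (C p.1) | p <- s] /\
      J (C p.2) \in [seq J (C p.2) | p <- s].
    by split; apply/mapP; exists p.
  by split; [| |apply: gp..]; apply: fys; rewrite !mem_cat ?m1 ?m2 ?m3 ?m4 ?orbT.
rewrite conjugationZ // (conjugation_involutive hJ) innerZl conjCK inner_normE.
by rewrite expr2 mulKf // gt_eqF.
Qed.

End Pairing.

(** * Linear spans *)

Section LinearSpanTheory.
Variables (K : numFieldType) (V : lmodType K).
Implicit Types A : set V.

Lemma lspan_gen A v : A v -> lspan A v.
Proof.
move=> Av; exists 1%N, (fun=> 1), (fun=> v); split=> //.
by rewrite big_ord1 scale1r.
Qed.

Lemma lspan0 A : lspan A 0.
Proof.
by exists 0%N, (fun=> 0), (fun=> 0); split=> [[]//|]; rewrite big_ord0.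
Qed.

Lemma lspanD A u v : lspan A u -> lspan A v -> lspan A (u + v).
Proof.
move=> [n [c [x [Ax ->]]]] [m [d [y [Ay ->]]]].
exists (n + m)%N, (fun i => match fintype.split i with inl j => c j | inr j => d j end),
  (fun i => match fintype.split i with inl j => x j | inr j => y j end); split.
  by move=> i; case: (fintype.split i).
rewrite big_split_ord /=; congr (_ + _); apply: eq_bigr => i _.
  by rewrite (unsplitK (inl i)).
by rewrite (unsplitK (inr i)).
Qed.

Lemma lspanZ A a v : lspan A v -> lspan A (a *: v).
Proof.
move=> [n [c [x [Ax ->]]]]; exists n, (fun i => a * c i), x; split=> //.
by rewrite scaler_sumr; apply: eq_bigr => i _; rewrite scalerA.
Qed.

Lemma lspan_sum A I (s : seq I) (P : pred I) (v : I -> V) :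
  (forall i, P i -> lspan A (v i)) -> lspan A (\sum_(i <- s | P i) v i).
Proof.
move=> Av; elim/big_ind: _ => //; [exact: lspan0|exact: lspanD].
Qed.

End LinearSpanTheory.

Lemma lspan_linear (K : numFieldType) (V W : lmodType K) (f : {linear V -> W})
  (A : set V) (B : set W) v :
  (forall x, A x -> lspan B (f x)) -> lspan A v -> lspan B (f v).
Proof.
move=> fAB [n [c [x [Ax ->]]]]; rewrite linear_sum.
by apply: lspan_sum => i _; rewrite linearZ; apply/lspanZ/fAB.
Qed.

(** * Anticommutation relations and BCS states *)

Section FockTheory.
Variables (R : realType) (L F : hilbertType R) (J : L -> L).
Variables (a adag : L -> {linear F -> F}) (Omega : F).
Hypothesis hJ : is_conjugation J.
Hypothesis hF : is_fock_representation J a adag Omega.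
Implicit Types (f g h : L) (X Y : F).

Lemma inner_adag f X Y : inner (adag (J f) X) Y = inner X (a f Y).
Proof. by rewrite (fock_adjoint hF). Qed.

Lemma a_adag h f X : a h (adag f X) = inner (J h) f *: X - adag f (a h X).
Proof. by rewrite -(fock_car_ac hF) addrK. Qed.

Lemma adag_anticomm f g X : adag f (adag g X) = - adag g (adag f X).
Proof. by apply/eqP; rewrite -addr_eq0 (fock_car_cc hF). Qed.

Lemma a_adag_adag h f g X : a h X = 0 ->
  a h (adag f (adag g X)) = inner (J h) f *: adag g X - inner (J h) g *: adag f X.
Proof. move=> aX; rewrite !a_adag aX linear0 subr0. by rewrite [adag f _]linearZ. Qed.

(** [X] acts as a vacuum for [h] and [k], and the scalar is the two-particle determinant. *)
Lemma a_a_adag_adag h k f g X : a h X = 0 -> a k X = 0 ->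
  a k (a h (adag f (adag g X))) =
  (inner (J h) f * inner (J k) g - inner (J h) g * inner (J k) f) *: X.
Proof.
move=> hX kX; rewrite a_adag_adag // linearB 2![a k (_ *: _)]linearZ /=.
by rewrite !a_adag kX !linear0 !addr0 scalerBl !scalerA.
Qed.

Definition create_pair (p : L * L) X : F := adag (J p.1) (adag (J p.2) X).

(* The (unnormalised) BCS product state. *)
Definition bcs (s : seq (L * L)) : F :=
  foldr (fun p X => X + create_pair p X) Omega s.

Lemma inner_create_pair p X Y :
  inner (create_pair p X) Y = inner X (a p.2 (a p.1 Y)).
Proof. by rewrite /create_pair !inner_adag. Qed.

(** [a h] passes each pair creator at the cost of inner products that vanish, until it meets the
    vacuum. *)
Lemma a_bcs0 h s :
  (forall p, p \in s -> inner h p.1 = 0 /\ inner h p.2 = 0) -> a h (bcs s) = 0.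
Proof.
elim: s => [_|p s IH hs] /=; first exact: (fock_vacuum_annihilated hF).
have ah0 : a h (bcs s) = 0 by apply: IH => q qs; apply: hs; rewrite inE qs orbT.
have [h1 h2] := hs p (mem_head _ _).
rewrite linearD /= ah0 add0r a_adag_adag // !inner_conjugation //.
by rewrite (innerC h) h1 (innerC h) h2 !rmorph0 !scale0r subrr.
Qed.

Lemma pair_vacuum (f g : L) X : `|f| = 1 -> `|g| = 1 -> inner f g = 0 ->
  a f X = 0 -> a g X = 0 -> a g (a f (create_pair (f, g) X)) = X.
Proof.
move=> nf ng fg fX gX; rewrite a_a_adag_adag // !inner_conjugation //=.
rewrite !inner_normE nf ng (innerC f) fg rmorph0 expr1n mul0r mulr1 subr0.
by rewrite scale1r.
Qed.

Variable C : {linear L -> L}.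
Hypothesis hCT : is_transpose J C (fun f => - C f).

Lemma pairing_annihilates t f g s : pairing J C t ((f, g) :: s) ->
  a f (bcs s) = 0 /\ a g (bcs s) = 0.
Proof.
by case=> _ _ os _; split; apply: a_bcs0 => p /os[].
Qed.

(** Each pair doubles the squared norm: the two summands are orthogonal and, by [pair_vacuum], of
    equal norm. *)
Lemma norm_bcs t s : pairing J C t s -> `|bcs s| ^+ 2 = 2 ^+ size s.
Proof.
elim: s => [_|[f g] s IH ps] /=; first by rewrite (fock_vacuum_unit hF) expr1n.
have [af ag] := pairing_annihilates ps.
case: ps => ps [nf ng fg] _ _.
rewrite normD_orthogonal; last first.
  by rewrite innerC inner_create_pair /= af linear0 linear0 rmorph0.
rewrite -[`|create_pair _ _| ^+ 2]inner_normE inner_create_pair.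
by rewrite pair_vacuum // inner_normE IH // exprS; ring.
Qed.

(** * The series of Delta^+ on the vacuum and on BCS states *)

Variable e : nat -> L.
Hypothesis he : complete_orthonormal e.

Definition Delta_term X j : F := adag (C (e j)) (adag (J (e j)) X).

(** Each creator of the pair anticommutes past two creators, so all signs cancel. *)
Lemma create_pair_Delta_term p X j :
  Delta_term (create_pair p X) j = create_pair p (Delta_term X j).
Proof.
rewrite /Delta_term /create_pair.
rewrite (adag_anticomm (J (e j)) (J p.1)) (adag_anticomm (J (e j)) (J p.2)).
rewrite !linearN opprK (adag_anticomm (C (e j)) (J p.1)).
by rewrite (adag_anticomm (C (e j)) (J p.2)) linearN opprK.
Qed.

(** The annihilators are continuous, so the limit is computed term by term: the determinants form
    the difference of two Parseval series with sums (J C g, f) and (J C f, g), which are opposite by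
    skewness; hence the factor 2. *)
Lemma a_a_Delta f g X Y : a f X = 0 -> a g X = 0 ->
  series (Delta_term X) @ \oo --> Y ->
  a g (a f Y) = - (2 * inner (J g) (C f)) *: X.
Proof.
move=> fX gX SY.
have ca h : continuous (a h) by apply: (fock_a_bounded hF).
have : a g \o (a f \o series (Delta_term X)) @ \oo --> a g (a f Y).
  apply: continuous_cvg; first exact: ca.
  by apply: continuous_cvg; first exact: ca.
have JCE h p : inner (J (C h)) p = inner (J p) (C h).
  by rewrite -{1}[p](conjugation_involutive hJ) inner_conjugation.
pose u h k n : R[i]^o := series (fun j => inner h (e j) * inner (e j) k) n.
rewrite (_ : _ \o _ =
    fun n => (u (J (C g)) f n - u (J (C f)) g n) *: X); last first.
  apply/funext => n; rewrite /= /u /series /= [a f _]linear_sum [a g _]linear_sum.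
  rewrite -sumrB scaler_suml.
  apply: eq_bigr => j _; rewrite a_a_adag_adag // !inner_conjugation // !JCE.
  by rewrite (skew_inner hJ hCT f) (skew_inner hJ hCT g); congr (_ *: _); ring.
have -> : - (2 * inner (J g) (C f)) = inner (J (C g)) f - inner (J (C f)) g.
  by rewrite !JCE (skew_inner hJ hCT f); ring.
move/cvg_unique; apply=> //; apply: cvgZr_tmp.
by apply: cvgB; apply: Parseval.
Qed.

(** The Gram matrix is the sum of a diagonal part |C x_i|^2 and the entries |b i j|^2. The first
    contributes the sum once, and Bessel bounds the second by the same sum. *)
Lemma norm_pair_sum_vacuum (I : finType) (x : I -> L) :
  (forall i j, inner (x i) (x j) = (i == j)%:R) ->
  `|\sum_i adag (C (x i)) (adag (J (x i)) Omega)| ^+ 2 <=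
  2 * \sum_i `|C (x i)| ^+ 2.
Proof.
move=> ox; pose X i := adag (C (x i)) Omega; pose b i j := inner (J (x i)) (C (x j)).
have aX i j : a (x i) (X j) = b i j *: Omega.
  by rewrite a_adag (fock_vacuum_annihilated hF) linear0 subr0.
have nX i : inner (adag (C (x i)) Omega) (X i) = `|C (x i)| ^+ 2.
  rewrite -{1}[C (x i)](conjugation_involutive hJ) inner_adag a_adag.
  rewrite (fock_vacuum_annihilated hF) (conjugation_involutive hJ) linear0 subr0.
  by rewrite linearZ /= !inner_normE (fock_vacuum_unit hF) expr1n mulr1.
have bE i j : inner (adag (J (x i)) (X i)) (adag (J (x j)) (X j)) =
    (i == j)%:R * inner (X i) (X j) + `|b i j| ^+ 2.
  rewrite inner_adag a_adag inner_conjugation // ox eq_sym linearB linearZ /= aX.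
  rewrite linearZ /= linearZ /= [inner _ (adag _ _)]innerC inner_adag aX.
  rewrite [inner Omega _]linearZ /= inner_normE (fock_vacuum_unit hF) expr1n mulr1.
  by rewrite {2}/b (skew_inner hJ hCT) -/(b i j) rmorphN mulrN opprK normCK.
under eq_bigr do rewrite adag_anticomm -/(X _).
rewrite sumrN normrN -inner_normE inner_suml.
under eq_bigr do rewrite linear_sum /=.
under eq_bigr do under eq_bigr do rewrite bE.
under eq_bigr do rewrite big_split /=.
rewrite big_split /= mulr2n mulrDl mul1r lerD //.
  rewrite le_eqVlt; apply/orP; left; apply/eqP/eq_bigr => i _.
  rewrite (bigD1 i) //= eqxx mul1r nX big1 ?addr0 // => j /negPf ij.
  by rewrite eq_sym ij mul0r.
rewrite exchange_big /=; apply: ler_sum => j _.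
rewrite -(conjugation_isometry hJ); apply: le_trans (Bessel ox _).
apply: ler_sum => i _; rewrite /b.
by rewrite -{2}[x i](conjugation_involutive hJ) inner_conjugation // innerC norm_conjC.
Qed.

(** Cauchy criterion: [norm_pair_sum_vacuum] bounds each block of the series by the matching block
    of the convergent series of |C e_j|^2. *)
Lemma Delta_vacuum_cvg (S : R) :
  (forall n, \sum_(j < n) `|C (e j)| ^+ 2 <= S%:C%C) ->
  cvgn (series (Delta_term Omega)).
Proof.
move=> CS; pose c j : R := complex.Re (`|C (e j)| ^+ 2).
have cE j : (c j)%:C%C = `|C (e j)| ^+ 2.
  by rewrite RRe_real // rpredX // normr_real.
have c0 j : 0 <= c j by rewrite -ler0c cE exprn_ge0.
have : cvgn (series c).
  apply: nondecreasing_is_cvgn; first exact: nondecreasing_series.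
  exists S => _ [n _ <-]; rewrite -lecR /series /= big_mkord rmorph_sum /=.
  by under eq_bigr do rewrite cE; exact: CS.
move/cauchy_cvgP/cauchy_seriesP => cS.
apply/cauchy_cvgP/cauchy_seriesP => eps eps0.
have epsE : ((complex.Re eps)%:C)%C = eps by rewrite RRe_real // gtr0_real.
(* The 2 is the constant of [norm_pair_sum_vacuum]. *)
have d0 : 0 < complex.Re eps ^+ 2 / 2.
  by rewrite divr_gt0 // exprn_gt0 // -ltcR epsE.
apply: filterS (cS _ d0) => -[m n] /=.
rewrite ger0_norm ?sumr_ge0 // => cmn.
rewrite -(ltr_pXn2r (n := 2)) ?nnegrE ?(ltW eps0) //.
rewrite -{1}[m]add0n big_addn big_mkord.
apply: le_lt_trans (norm_pair_sum_vacuum (x := fun i : 'I_(n - m) => e (i + m)) _) _.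
  by move=> i j; case: he => -> _; rewrite eqn_add2r.
rewrite -epsE -rmorphXn /= mulrC -ltr_pdivlMr //.
under eq_bigr do rewrite -cE.
move: cmn; rewrite -{1}[m]add0n big_addn big_mkord.
rewrite -ltcR rmorph_sum /= => /lt_le_trans; apply.
by rewrite rmorphM fmorphV /= rmorph_nat.
Qed.

(** This is Delta^+ applied to [bcs s] when [Y] is Delta^+ applied to the vacuum. *)
Definition Delta_bcs Y (s : seq (L * L)) : F :=
  foldr (fun p Z => Z + create_pair p Z) Y s.

Lemma create_pair_continuous p : continuous (create_pair p).
Proof.
by move=> X; apply: cvg_comp; apply: (fock_adag_bounded hF).
Qed.

(** Convergence is inherited from the vacuum, since pair creation is continuous and commutes with
    every term. *)
Lemma Delta_bcs_cvg Y s : series (Delta_term Omega) @ \oo --> Y ->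
  series (Delta_term (bcs s)) @ \oo --> Delta_bcs Y s.
Proof.
move=> SY; elim: s => [//|p s IH] /=.
have -> : series (Delta_term (bcs s + create_pair p (bcs s))) =
    (fun n => series (Delta_term (bcs s)) n +
      create_pair p (series (Delta_term (bcs s)) n)).
  apply/funext => n; rewrite /series /=.
  rewrite {2}/create_pair !linear_sum -big_split; apply: eq_bigr => j _ /=.
  by rewrite -[adag _ (adag _ (Delta_term _ _))]create_pair_Delta_term /Delta_term
    !linearD.
by apply: cvgD => //; apply: (cvg_comp _ _ IH); apply: create_pair_continuous.
Qed.

Lemma inner_vacuum_Delta Y : series (Delta_term Omega) @ \oo --> Y ->
  inner Omega Y = 0.
Proof.
move=> SY.
have : cst (0 : R[i]^o) @ \oo --> (inner Omega Y : R[i]^o).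
  rewrite (_ : cst 0 = (fun n => inner Omega (series (Delta_term Omega) n))).
    by apply: inner_cvg.
  apply/funext => n; rewrite linear_sum big1 // => j _.
  rewrite /= /Delta_term -[C _](conjugation_involutive hJ) innerC inner_adag.
  by rewrite (fock_vacuum_annihilated hF) linear0 rmorph0.
by move/cvg_unique; apply=> //; apply: cvg_cst.
Qed.

(** A new pair doubles the old inner product and adds - 2 (J g, C f) |X|^2, where |X|^2 = 2^(size
    s). *)
Lemma inner_bcs_Delta Y t s : series (Delta_term Omega) @ \oo --> Y ->
  pairing J C t s ->
  2 ^+ size s * (size s)%:R * t <= - inner (bcs s) (Delta_bcs Y s).
Proof.
move=> SY; elim: s => [_|[f g] s IH ps].
  by rewrite mulr0 mul0r inner_vacuum_Delta ?oppr0.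
have [af ag] := pairing_annihilates ps.
have aDs := a_a_Delta af ag (Delta_bcs_cvg SY).
case: ps => ps [nf ng fg] _ tfg; have {}IH := IH ps.
rewrite [Delta_bcs Y _]/= [bcs _]/= [size _]/=.
set X := bcs s in af ag IH aDs *; set Z := Delta_bcs Y s in IH aDs *.
have XPZ : inner X (create_pair (f, g) Z) = 0.
  by rewrite innerC inner_create_pair /= af !linear0 rmorph0.
(* The annihilators are moved onto the pair state over [X], because [Z] need not be annihilated by
   [a f] and [a g]. *)
have PXPZ : inner (create_pair (f, g) X) (create_pair (f, g) Z) = inner X Z.
  by rewrite innerC inner_create_pair pair_vacuum // -innerC.
have PXZ : inner (create_pair (f, g) X) Z = - (2 * inner (J g) (C f)) * 2 ^+ size s.
  by rewrite inner_create_pair aDs linearZ /= inner_normE (norm_bcs ps).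
rewrite innerDl 2![inner _ (_ + _)]linearD /= XPZ PXPZ PXZ addr0.
have -> : - (inner X Z + (- (2 * inner (J g) (C f)) * 2 ^+ size s + inner X Z)) =
    2 * - inner X Z + 2 ^+ (size s).+1 * inner (J g) (C f) by rewrite exprS; ring.
have -> : 2 ^+ (size s).+1 * (size s).+1%:R * t =
    2 * (2 ^+ size s * (size s)%:R * t) + 2 ^+ (size s).+1 * t.
  by rewrite exprS -natr1; ring.
by rewrite lerD // ler_wpM2l // exprn_ge0.
Qed.
End FockTheory.

(** * Orthogonality of the n-particle spaces and powers of the number operator *)

Lemma inner_lspan_eq0 (R : realType) (H : hilbertType R) (A : set H) f g :
  (forall x, A x -> inner f x = 0) -> lspan A g -> inner f g = 0.
Proof.
move=> fA [n [c [x [Ax ->]]]]; rewrite linear_sum big1 // => i _.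
by rewrite linearZ /= fA ?mulr0.
Qed.

Section ParticleNumber.
Variables (R : realType) (L F : hilbertType R) (J : L -> L).
Variables (a adag : L -> {linear F -> F}) (Omega : F).
Hypothesis hJ : is_conjugation J.
Hypothesis hF : is_fock_representation J a adag Omega.
Implicit Types (f g h : L) (X Y : F) (n m : nat).

Definition nspan n : set F :=
  lspan [set creation_vector adag Omega fs | fs in [set fs | size fs = n]].

Lemma adag_nspan f n X : nspan n X -> nspan n.+1 (adag f X).
Proof.
apply: lspan_linear => _ [fs fsn <-]; apply: lspan_gen.
by exists (f :: fs) => //=; rewrite fsn.
Qed.

Lemma a_nspan h n X : nspan n.+1 X -> nspan n (a h X).
Proof.
move=> nX; apply: lspan_linear nX => _ [fs fsn <-].
elim: fs n fsn => //= f fs IH n [fsn].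
rewrite (a_adag hF); apply: lspanD.
  by apply/lspanZ/lspan_gen; exists fs.
rewrite -scaleN1r; apply: lspanZ.
case: n => [|n] in fsn *; last by apply/adag_nspan/IH.
move/size0nil: fsn => ->; rewrite (fock_vacuum_annihilated hF) linear0.
exact: lspan0.
Qed.

(** Creators move across as annihilators, each lowering the degree of [Y], until the vacuum faces a
    vector of positive degree. *)
Lemma creation_vector_orthogonal fs n Y :
  (size fs < n)%N -> nspan n Y -> inner (creation_vector adag Omega fs) Y = 0.
Proof.
elim: fs n Y => [|f fs IH] [//|n] Y /=.
  move=> _; apply: inner_lspan_eq0 => _ [[//|g gs] _ <-] /=.
  rewrite innerC -[g](conjugation_involutive hJ) (inner_adag hF).
  by rewrite (fock_vacuum_annihilated hF) linear0 rmorph0.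
move=> fsn nY; rewrite -[f](conjugation_involutive hJ) (inner_adag hF).
by apply: IH fsn _; apply: a_nspan.
Qed.

Lemma particle_space_orthogonal n m X Y : n != m ->
  particle_space adag Omega n X -> particle_space adag Omega m Y -> inner X Y = 0.
Proof.
wlog nm : n m X Y / (n < m)%N.
  move=> H; rewrite neq_ltn => /orP[nm|mn] nX mY.
    by apply: (H n m); rewrite ?ltn_eqF.
  by rewrite innerC (H m n) ?ltn_eqF ?rmorph0.
move=> _; apply: inner_closure_eq0 => x y nx my.
rewrite innerC (inner_lspan_eq0 _ nx) ?rmorph0 // => _ [fs fsn <-].
by rewrite innerC (creation_vector_orthogonal _ my) ?rmorph0 ?fsn.
Qed.

Lemma nspan_particle_space n X : nspan n X -> particle_space adag Omega n X.
Proof. exact: subset_closure. Qed.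

Lemma finite_particle_sum m (phi : nat -> F) : (forall n, nspan n (phi n)) ->
  finite_particle adag Omega (\sum_(n < m) phi n).
Proof.
move=> nphi; exists m, (fun=> 1), (fun n => phi n); split.
  by move=> n; exists n => //; apply: nspan_particle_space.
by apply: eq_bigr => n _; rewrite scale1r.
Qed.

Lemma bcs_nspan (s : seq (L * L)) : exists2 phi : nat -> F,
  (forall n, nspan n (phi n)) & bcs J adag Omega s = \sum_(n < (size s).*2.+1) phi n.
Proof.
(* One more pair lengthens the sum by two terms, so the induction must also know that [phi] vanishes
   above the top degree. *)
suff [phi [nphi _ ->]] : exists phi : nat -> F, [/\ forall n, nspan n (phi n),
    forall n, ((size s).*2 < n)%N -> phi n = 0 &
    bcs J adag Omega s = \sum_(n < (size s).*2.+1) phi n] by exists phi.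
elim: s => [|p s [phi [nphi phi0 IH]]].
  exists (fun n => if n is 0%N then Omega else 0); split.
  - by case=> [|n]; [apply: lspan_gen; exists [::] | apply: lspan0].
  - by case.
  - by rewrite big_ord1.
exists (fun n => phi n +
  if n is k.+2 then create_pair J adag p (phi k) else 0); split.
- case=> [|[|n]]; rewrite ?addr0 //.
  by apply: lspanD; [exact: nphi | exact: (adag_nspan _ (adag_nspan _ (nphi n)))].
- move=> [|[|n]] //=; rewrite doubleS !ltnS => sn.
  by rewrite !phi0 /create_pair ?linear0 ?addr0 //; lia.
rewrite /= big_split /= doubleS; congr (_ + _).
  by rewrite [RHS]big_ord_recr [in RHS]big_ord_recr /= -IH !phi0 ?addr0 //; lia.
rewrite [RHS]big_ord_recl [in RHS]big_ord_recl /= !add0r IH.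
by rewrite /create_pair !linear_sum.
Qed.

Lemma number_power_le m (phi : nat -> F) (s : R) Phi : 0 <= s ->
  (forall n, nspan n (phi n)) -> Phi = \sum_(n < m.+1) phi n ->
  0 <= inner Phi (number_power adag Omega s Phi) <= (m%:R `^ s)%:C%C * `|Phi| ^+ 2.
Proof.
move=> s0 nphi PhiE0; rewrite /number_power.
set P := [set Psi | _].
have : P (get P).
  apply: getPex; rewrite /P PhiE0; exists (\sum_(n < m.+1) (n%:R `^ s)%:C%C *: phi n).
  exists m.+1, (fun n => phi n); split=> // n; exact: nspan_particle_space.
(* The decomposition picked by [get] need not be [phi]; orthogonality forces its components above
   degree [m] to vanish. *)
case=> m' [psi [npsi PhiE ->]].
have Phipsi (n : 'I_m') : inner Phi (psi n) = `|psi n| ^+ 2.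
  rewrite PhiE inner_suml (bigD1 n) //= inner_normE big1 ?addr0 // => k kn.
  by apply: (@particle_space_orthogonal k n) => //; rewrite val_eqE.
have psi0 (n : 'I_m') : (m < n)%N -> `|psi n| ^+ 2 = 0.
  move=> mn; rewrite -Phipsi PhiE0 inner_suml big1 // => k _.
  apply: (particle_space_orthogonal (n := k) (m := n)) => //.
    by rewrite ltn_eqF // (leq_trans _ mn).
  exact: nspan_particle_space.
rewrite linear_sum; under eq_bigr do rewrite linearZ /= Phipsi.
have -> : `|Phi| ^+ 2 = \sum_(n < m') `|psi n| ^+ 2.
  by rewrite -inner_normE {2}PhiE linear_sum; apply: eq_bigr => n _; apply: Phipsi.
rewrite mulr_sumr sumr_ge0 /= => [|n _]; last first.
  by rewrite mulr_ge0 ?exprn_ge0 // ler0c powR_ge0.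
apply: ler_sum => n _; have [nm|mn] := leqP n m; last by rewrite psi0 ?mulr0.
rewrite ler_wpM2r ?exprn_ge0 // lecR ge0_ler_powR ?nnegrE ?ler0n //.
by rewrite ler_nat.
Qed.

End ParticleNumber.

(** * The operator inequality tested on BCS states *)

Section ParticleBound.
Variables (R : realType) (L F : hilbertType R) (J : L -> L).
Variables (a adag : L -> {linear F -> F}) (Omega : F).
Hypothesis hJ : is_conjugation J.
Hypothesis hF : is_fock_representation J a adag Omega.
Variable C : {linear L -> L}.
Hypothesis hCT : is_transpose J C (fun f => - C f).
Variable e : nat -> L.
Hypothesis he : complete_orthonormal e.
Variables (S s gamma delta : R).
Hypothesis s0 : 0 <= s.
Hypothesis CS : forall n, \sum_(j < n) `|C (e j)| ^+ 2 <= S%:C%C.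
Hypothesis hbound : forall Phi : F, finite_particle adag Omega Phi ->
  `|Delta_plus J adag e C Phi| ^+ 2 <=
  inner Phi (gamma%:C%C *: number_power adag Omega s Phi + delta%:C%C *: Phi).

Lemma pairing_bound (t : R) q : 0 <= t -> pairing J C t%:C%C q ->
  ((size q)%:R * t) ^+ 2 <= `|gamma| * (size q).*2%:R `^ s + `|delta|.
Proof.
move=> t0 pq; have [phi nphi bE] := bcs_nspan J adag Omega q.
set Phi := bcs J adag Omega q in bE.
have nPhi : `|Phi| ^+ 2 = 2 ^+ size q by apply: (norm_bcs hJ hF pq).
have /hbound : finite_particle adag Omega Phi.
  by rewrite bE; apply: finite_particle_sum.
have SY : cvgn (series (Delta_term J adag C e Omega)).
  exact: (Delta_vacuum_cvg hJ hF hCT he CS).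
set Y := limn _ in SY.
have -> : Delta_plus J adag e C Phi = Delta_bcs J adag Y q.
  by apply: cvg_lim => //; apply: (Delta_bcs_cvg hF).
have := inner_bcs_Delta hJ hF hCT he SY pq.
rewrite -/Phi; set D := Delta_bcs _ _ _ _ => lowD upD.
have low0 : 0 <= 2 ^+ size q * (size q)%:R * t%:C%C :> R[i].
  by rewrite !mulr_ge0 ?ler0n ?exprn_ge0 // ler0c.
have : (2 ^+ size q * (size q)%:R * t%:C%C) ^+ 2 <= 2 ^+ size q * `|D| ^+ 2.
  rewrite -[X in _ <= X * _]nPhi -exprMn ler_sqr ?nnegrE ?mulr_ge0 // ?ler0c //.
  apply: le_trans (inner_CauchySchwarz _ _); rewrite -[leRHS]normrN.
  apply: (le_trans lowD); apply: real_ler_norm.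
  by rewrite ger0_real // (le_trans low0).
rewrite -mulrA exprMn expr2 -mulrA ler_pM2l ?exprn_gt0 // => lowD2.
have {lowD2}upD2 := le_trans lowD2 upD.
have /andP[N0 N1] := number_power_le hJ hF s0 nphi bE.
(* The signs of [gamma] and [delta] are unknown; both expectations are nonnegative, so absolute
   values may replace them. *)
have : inner Phi (gamma%:C%C *: number_power adag Omega s Phi + delta%:C%C *: Phi)
    <= 2 ^+ size q * (`|gamma| * (size q).*2%:R `^ s + `|delta|)%:C%C.
  rewrite linearD /= 2!linearZ /= inner_normE nPhi.
  rewrite rmorphD rmorphM /= mulrDr; apply: lerD; last first.
    by rewrite mulrC ler_wpM2l ?exprn_ge0 // lecR ler_norm.
  apply: (@le_trans _ _ (`|gamma|%:C%C * inner Phi (number_power adag Omega s Phi))).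
    by rewrite ler_wpM2r // lecR ler_norm.
  rewrite mulrCA ler_wpM2l ?ler0c //.
  by move: N1; rewrite nPhi mulrC.
move/(le_trans upD2); rewrite ler_pM2l ?exprn_gt0 //.
by rewrite -lecR rmorphXn rmorphM /= rmorph_nat.
Qed.

End ParticleBound.

(** * Sums of real powers *)

Section RealSums.
Variable R : realType.
Implicit Types (x y : R).

(** Mean value theorem for z^(-y) on [x, x + 1]: the modulus of the derivative is smallest at the
    right end. *)
Lemma powR_telescope x y : 0 < x -> 0 < y ->
  ((x + 1) `^ (1 + y))^-1 <= y^-1 * ((x `^ y)^-1 - ((x + 1) `^ y)^-1).
Proof.
move=> x0 y0; have xx1 : x <= x + 1 by rewrite lerDl.
have pos c : c \in `[x, x + 1] -> 0 < c.
  by rewrite in_itv /= => /andP[/(lt_le_trans x0)].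
have der (c : R) : 0 < c ->
    is_derive c 1 (fun z : R => z `^ (- y)) (- y * c `^ (- y - 1)).
  exact: is_derive1_powR.
have cont : {within `[x, x + 1], continuous (fun z : R => z `^ (- y))}.
  apply: derivable_within_continuous => c /pos/der cder; exact: ex_derive.
have der' c : c \in `]x, x + 1[ ->
    is_derive c 1 (fun z : R => z `^ (- y)) (- y * c `^ (- y - 1)).
  by move=> /subset_itv_oo_cc/pos/der.
have [c cx] := MVT_segment xx1 der' cont.
rewrite addrAC subrr add0r mulr1 => /(congr1 -%R); rewrite opprB !powRN => ->.
have c0 := pos _ cx; rewrite mulNr opprK mulKf ?gt_eqF //.
rewrite -opprD powRN [1 + y]addrC lef_pV2 ?posrE ?powR_gt0 //; last by rewrite ltr_wpDr.
rewrite ge0_ler_powR ?nnegrE ?addr_ge0 ?(ltW y0) ?(ltW c0) ?(ltW x0) //.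
by move: cx; rewrite in_itv /= => /andP[].
Qed.

Lemma riemannR_series_le y n : 0 < y -> \sum_(k < n) riemannR (1 + y) k <= 1 + y^-1.
Proof.
move=> y0; case: n => [|n].
  by rewrite big_ord0 addr_ge0 // invr_ge0 ltW.
(* The subtracted term (n + 1)^(-y) is what lets the induction telescope. *)
suff h : \sum_(k < n.+1) riemannR (1 + y) k <= 1 + y^-1 * (1 - (n.+1%:R `^ y)^-1).
  by apply: (le_trans h); rewrite lerD2l ler_piMr ?invr_ge0 ?(ltW y0) //.
elim: n => [|n IH].
  by rewrite big_ord1 /riemannR !powR1 invr1 subrr mulr0 addr0.
rewrite big_ord_recr; apply: le_trans (lerD IH (lexx _)) _.
rewrite -addrA lerD2l -lerBrDl -mulrBr.
rewrite (_ : 1 - _ - _ = (n.+1%:R `^ y)^-1 - (n.+2%:R `^ y)^-1); last by ring.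
by have := @powR_telescope n.+1%:R y; rewrite natr1; apply.
Qed.

(* This replaces the decreasing rearrangement of [w]. *)
Lemma sum_le_of_exists_le (w b : nat -> R) :
  (forall A, uniq A -> A != [::] -> exists2 j, j \in A & w j <= b (size A).-1) ->
  forall A, uniq A -> \sum_(j <- A) w j <= \sum_(k < size A) b k.
Proof.
move=> wb A; move: {2}(size A) (erefl (size A)) => n; elim: n A => [|n IH] A sA uA.
  by rewrite (size0nil sA) big_nil big_ord0.
have [|j jA wj] := wb A uA; first by rewrite -size_eq0 sA.
rewrite (big_rem j) //= sA big_ord_recr /= addrC lerD //.
  have sr : size (rem j A) = n by rewrite size_rem // sA.
  by rewrite -[in leRHS]sr IH // rem_uniq.
by rewrite sA in wj.
Qed.

End RealSums.

(** * Lower bounds on spans of singular vectors *)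

Section SingularValues.
Variables (R : realType) (L : hilbertType R).
Variables (C : {linear L -> L}) (Cs : L -> L) (mu : nat -> R) (u : nat -> L).
Hypothesis hCs : is_adjoint C Cs.
Hypothesis hu : complete_orthonormal u.
Hypothesis mu0 : forall j, 0 <= mu j.
Hypothesis hmu : forall j, Cs (C (u j)) = (mu j ^+ 2)%:C%C *: u j.

Lemma inner_C_singular i j :
  inner (C (u i)) (C (u j)) = (mu i ^+ 2)%:C%C * (i == j)%:R.
Proof.
rewrite hCs hmu innerZl (proj1 hu) conj_Creal //.
by rewrite ger0_real // ler0c sqr_ge0.
Qed.

Lemma norm_C_singular j : `|C (u j)| ^+ 2 = (mu j ^+ 2)%:C%C.
Proof. by rewrite -inner_normE inner_C_singular eqxx mulr1. Qed.

(** Images of distinct singular vectors are orthogonal, so both squared norms are sums over [i],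
    compared term by term. *)
Lemma norm_C_ge n (A : 'I_n -> nat) (t : R) : injective A -> 0 <= t ->
  (forall i, t <= mu (A i)) -> forall c : 'I_n -> R[i],
  t%:C%C * `|\sum_i c i *: u (A i)| <= `|C (\sum_i c i *: u (A i))|.
Proof.
move=> iA t0 tmu c; rewrite -ler_sqr ?nnegrE ?mulr_ge0 ?ler0c // exprMn.
rewrite norm_orthonormal_sum => [|i j]; last by rewrite (proj1 hu) inj_eq.
rewrite linear_sum -inner_normE inner_suml mulr_sumr; apply: ler_sum => i _.
rewrite linear_sum (bigD1 i) //= big1 => [|j ji]; last first.
  rewrite !linearZ /= innerZl inner_C_singular inj_eq // eq_sym (negPf ji).
  by rewrite !mulr0.
rewrite addr0 !linearZ /= innerZl inner_C_singular eqxx mulr1.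
rewrite [leRHS](_ : _ = (mu (A i) ^+ 2)%:C%C * `|c i| ^+ 2); last first.
  by rewrite normCK; ring.
rewrite ler_wpM2r ?exprn_ge0 // -rmorphXn lecR ler_sqr ?nnegrE //.
Qed.

End SingularValues.

(** * Decay of the singular values and summability *)

Lemma ceil_quarter (n : nat) : (0 < n)%N ->
  exists M, [/\ (0 < M)%N, (n <= 4 * M)%N & (4 * M < n + 4)%N].
Proof. by move=> n0; exists ((n + 3) %/ 4)%N; split; lia. Qed.

(** Solving (M t)^2 = O(M^s) gives t = O(M^(s/2 - 1)), where s/2 - 1 = - 1/r; replacing M by n/4
    costs the power of 4. *)
Lemma pairing_bound_powR (R : realType) (r p t g d : R) (M n : nat) :
  1 <= r -> 0 < p -> 0 <= t -> 0 <= g -> 0 <= d -> (0 < M)%N -> (0 < n <= 4 * M)%N ->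
  (M%:R * t) ^+ 2 <= g * M.*2%:R `^ (2 * (r - 1) / r) + d ->
  t `^ p <= (g * 2 `^ (2 * (r - 1) / r) + d) `^ (p / 2) * 4 `^ (p / r) *
            (n%:R `^ (p / r))^-1.
Proof.
move=> r1 p0 t0 g0 d0 M0 /andP[n0 nM] MtL; set s := 2 * (r - 1) / r in MtL *.
set c := _ + d.
have r0 : 0 < r by apply: lt_le_trans r1.
have s0 : 0 <= s by rewrite divr_ge0 ?mulr_ge0 ?subr_ge0 // ltW.
have c0 : 0 <= c by rewrite addr_ge0 // mulr_ge0 // powR_ge0.
have MR0 : 0 < M%:R :> R by rewrite ltr0n.
(* As M >= 1 and s >= 0, [d] is at most d M^s and is absorbed into the constant. *)
have {MtL} Mt : (M%:R * t) ^+ 2 <= c * M%:R `^ s.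
  apply: (le_trans MtL); rewrite -muln2 mulnC natrM powRM ?ler0n // mulrDl mulrA.
  by rewrite lerD2l ler_peMr // -[leLHS](powRr0 M%:R) ler_powR // ler1n.
have : ((M%:R * t) ^+ 2) `^ (p / 2) <= (c * M%:R `^ s) `^ (p / 2).
  by rewrite ge0_ler_powR ?nnegrE ?exprn_ge0 ?mulr_ge0 ?powR_ge0 ?ler0n
    ?divr_ge0 // ltW.
rewrite -powR_mulrn ?mulr_ge0 ?ler0n // -powRrM [2 * (p / 2)]mulrC divfK //.
rewrite !powRM ?powR_ge0 ?ler0n // -powRrM mulrC -ler_pdivlMr ?powR_gt0 //.
move=> /le_trans; apply.
rewrite -2!mulrA ler_wpM2l ?powR_ge0 //.
rewrite -(powRN M%:R) -powRD; last by rewrite (gt_eqF MR0) implybT.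
have -> : s * (p / 2) - p = - (p / r) by rewrite /s; field; rewrite gt_eqF.
rewrite powRN ler_pdivlMr ?powR_gt0 ?ltr0n // mulrC ler_pdivrMr ?powR_gt0 //.
rewrite -powRM ?ler0n //.
rewrite ge0_ler_powR ?nnegrE ?mulr_ge0 ?ler0n ?invr_ge0 ?(ltW p0) ?(ltW r0) //.
by rewrite -natrM ler_nat.
Qed.

Local Open Scope complex_scope.

Theorem theorem4p4 (R : realType) (L : hilbertType R)
    (Linf : infinite_dimensional L) (Lsep : separable L)
    (J : L -> L) (hJ : is_conjugation J)
    (F : hilbertType R) (a adag : L -> {linear F -> F}) (Omega : F)
    (hF : is_fock_representation J a adag Omega)
    (e : nat -> L) (he : complete_orthonormal e)
    (C : {linear L -> L}) (hC : schatten_minus J 2 C)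
    (r : R) (hr : 1 <= r <= 2) (gamma delta : R)
    (hbound : let s := 2 * (r - 1) / r in
       forall Phi : F, finite_particle adag Omega Phi ->
         `|Delta_plus J adag e C Phi| ^+ 2 <=
         inner Phi (gamma%:C *: number_power adag Omega s Phi
                    + delta%:C *: Phi)) :
  forall eps : R, 0 < eps -> schatten_minus J (r + eps) C.
Proof.
move=> eps eps0.
have [[compC [mu [mu0 [Cs [hCs [u hu hmu]]]] musum]] hCT] := hC.
(* Compactness, skewness and the list [mu] do not depend on the exponent; only summability
   remains. *)
split=> //; split=> //; exists mu; first by split=> //; exists Cs; split=> //; exists u.
have /andP[r1 _] := hr; have r0 : 0 < r by apply: lt_le_trans r1.
have p0 : 0 < r + eps by rewrite addr_gt0.
have [S muS] : exists S : R, forall n, \sum_(l < n) mu l ^+ 2 <= S.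
  exists (fine (\sum_(0 <= j <oo) (mu j `^ 2)%:E)%E) => n.
  rewrite -lee_fin fineK; last first.
    by rewrite ge0_fin_numE // nneseries_ge0 // => j _ _; rewrite lee_fin powR_ge0.
  apply: le_trans (nneseries_lim_ge n _); last by move=> j _; rewrite lee_fin powR_ge0.
  rewrite big_mkord sumEFin lee_fin; apply: ler_sum => j _.
  by rewrite -powR_mulrn.
have CS n : \sum_(j < n) `|C (e j)| ^+ 2 <= S%:C.
  apply: (HilbertSchmidt_le hJ hCT hu he) => m.
  under eq_bigr do rewrite (norm_C_singular hCs hu hmu).
  by rewrite -rmorph_sum lecR.
set s := 2 * (r - 1) / r in hbound.
have s0 : 0 <= s by rewrite divr_ge0 ?mulr_ge0 ?subr_ge0 // ltW.
(* Here [eps] enters: the decay exponent (r + eps) / r exceeds 1, so the comparison series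
   converges. *)
pose y := eps / r; have y0 : 0 < y by rewrite divr_gt0.
have pE : (r + eps) / r = 1 + y by rewrite mulrDl divff ?gt_eqF.
pose K := (`|gamma| * 2 `^ s + `|delta|) `^ ((r + eps) / 2) * 4 `^ ((r + eps) / r).
have K0 : 0 <= K by rewrite mulr_ge0 ?powR_ge0.
(* The minimum [t] of [mu] over [A] bounds [C] below on a space of dimension [size A]. [riemannR] at
   k is a power of k + 1, hence the predecessor. *)
have key A : uniq A -> A != [::] ->
    exists2 j, j \in A & mu j `^ (r + eps) <= K * riemannR (1 + y) (size A).-1.
  move=> uA; rewrite -size_eq0 -lt0n => A0.
  pose i0 := Ordinal A0.
  pose mA (i : 'I_(size A)) := mu (nth 0%N A i).
  case: (@arg_minP _ _ _ i0 xpredT mA) => // i _ mini.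
  exists (nth 0%N A i); first exact: mem_nth.
  rewrite /riemannR prednK // -pE.
  have iA : injective (fun k : 'I_(size A) => nth 0%N A k).
    by move=> k l /eqP; rewrite nth_uniq // => /eqP/val_inj.
  set t := mu _ in mini *; have t0 : 0 <= t by apply: mu0.
  (* [exists_pairing] asks for a positive bound, so a zero minimum is treated apart. *)
  have [->|tn0] := eqVneq t 0.
    by rewrite powR0 ?gt_eqF // mulr_ge0 // invr_ge0 powR_ge0.
  have tgt0 : 0 < t by rewrite lt_def tn0.
  have ltC := norm_C_ge hCs hu mu0 hmu iA t0 (fun k => mini k isT).
  have [M [M0 AM MA]] := ceil_quarter A0.
  have [||q qM pq] := @exists_pairing _ _ _ hJ _ hCT _ _ t%:C _ _ ltC _ MA.
  - by move=> k l; rewrite (proj1 hu) (inj_eq iA).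
  - by rewrite ltcR.
  have := pairing_bound hJ hF hCT he s0 CS hbound t0 pq; rewrite qM.
  by apply: pairing_bound_powR; rewrite ?A0.
have part n : \sum_(0 <= j < n) mu j `^ (r + eps) <= K * (1 + y^-1).
  have := @sum_le_of_exists_le R (fun j => mu j `^ (r + eps))
    (fun k => K * riemannR (1 + y) k) key _ (iota_uniq 0 n); rewrite size_iota.
  rewrite -mulr_sumr => h; rewrite /index_iota subn0; apply: (le_trans h).
  by rewrite ler_wpM2l // riemannR_series_le.
apply: (@le_lt_trans _ _ (K * (1 + y^-1))%:E); last exact: ltry.
apply: lime_le; first by apply: is_cvg_nneseries => j _ _; rewrite lee_fin powR_ge0.
by apply: nearW => n; rewrite sumEFin lee_fin.
Qed.
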